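(* Let $X$ and $Y$ be real valued random variables such that $\mathbb{E}\max\{0,Y\}<\infty$ and such that for all $\varphi\in E^*$, $\mathbb{E}\varphi(X)\leq\mathbb{E}\varphi(Y)$, where $E^*$ is the collection of all functions $\varphi_{t,a}:\mathbb{R}\to\mathbb{R}$ of the form $\varphi_{t,a}(x)=\max\{0,a(x-t)+1\}$ with $t\in\mathbb{R}$ and $a\in(0,\infty)$. Suppose that $T\geq 1$, $\gamma\geq 1$, $p>1$, and that $Q:(0,\infty)\to(0,\infty)$ is a function that satisfies \[ Q(t)\exp\left(\frac{-t^2}{2p}\right)\leq T\,Q(s)\exp\left(\frac{-s^2}{2p}\right) \] for all $0<s<t$. If $\mathbb{P}\left\{Y>Q(t)\right\}<\gamma\exp\left(-t^2/2\right)$ for all $t>0$, then for all $t>0$, \[ \mathbb{P}\left\{X>\frac{pT}{p-1}Q(t)\right\}\leq\gamma\exp\left(-t^2/2\right). \]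
   Context: $X$ and $Y$ need not be defined on the same probability space. *)

(* Defs.v *)
From HB Require Import structures.
From mathcomp Require Import all_boot all_order all_algebra.
From mathcomp Require Import all_classical all_reals all_analysis.
Set Implicit Arguments.
Unset Strict Implicit.
Unset Printing Implicit Defensive.
Import Order.TTheory GRing.Theory Num.Theory.
Import numFieldNormedType.Exports.
Local Open Scope classical_set_scope.
Local Open Scope ring_scope.

Definition phi {R : realType} (t a : R) : R -> R :=
  fun x => Num.max 0 (a * (x - t) + 1).

Definition Estar (R : realType) : set (R -> R) :=
  [set f | exists t a : R, 0 < a /\ f = phi t a].

(* Main.v *)
(** Put u = T Q(t) and c = p u / (p - 1). Taking s in the growth condition on Q
    with exp((s^2 - t^2) / (2p)) = v turns the Gaussian-type tail of Y into the
    power tail P(Y > u v) <= gamma exp(-t^2 / 2) v^(-p) for v >= 1. The test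
    function phi_{c,a} with a = (p - 1) / u vanishes up to u and equals 1 at c,
    so P(X > c) <= E phi_{c,a}(X) <= E phi_{c,a}(Y). By the layer-cake formula
    the last expectation is at most gamma exp(-t^2 / 2) times the integral over
    r >= 0 of (1 + r / (p - 1))^(-p), which is 1. *)
Require Import Defs.
From HB Require Import structures.
From mathcomp Require Import all_boot all_order all_algebra.
From mathcomp Require Import all_classical all_reals all_analysis.
From mathcomp Require Import measurable_realfun ring.
Set Implicit Arguments.
Unset Strict Implicit.
Unset Printing Implicit Defensive.
Import Order.TTheory GRing.Theory Num.Theory.
Import numFieldNormedType.Exports.
Local Open Scope classical_set_scope.
Local Open Scope ring_scope.

Lemma measurable_phi (R : realType) (t a : R) : measurable_fun setT (phi t a).
Proof.
apply: measurable_maxr => //; apply: measurable_funD => //.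
by apply: measurable_funM => //; apply: measurable_funB.
Qed.

(** Lets [phi t a \o X] be inferred as a random variable, as Markov's inequality and the layer-cake
    formula require. *)
HB.instance Definition _ (R : realType) (t a : R) :=
  isMeasurableFun.Build _ _ _ _ (phi t a) (@measurable_phi R t a).

Lemma phi_ge0 (R : realType) (t a x : R) : 0 <= phi t a x.
Proof. by rewrite /phi le_max lexx. Qed.

Lemma measurable_gt_mfun d (T : measurableType d) (R : realType)
    (X : {mfun T >-> R}) (t : R) : measurable [set w | t < X w].
Proof.
rewrite [X in measurable X](_ : _ = X @^-1` `]t, +oo[).
  exact: measurable_funPTI.
by apply/seteqP; split=> w /=; rewrite in_itv/= andbT.
Qed.

(** Markov's inequality at level 1: the test function is nonnegative and is at least 1 beyond [t],
    its slope being positive. *)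
Lemma prob_gt_le_expectation_phi d (T : measurableType d) (R : realType)
    (P : probability T R) (X : {RV P >-> R}) (t a : R) : 0 < a ->
  (P [set w | (t < X w)%R] <= 'E_P[phi t a \o X])%E.
Proof.
move=> a0.
pose Z : {RV P >-> R} := phi t a \o X.
have mid : measurable_fun [set: R] (@id R) by exact: measurable_id.
have := @markov _ _ _ P Z id 1 ltr01 mid (fun r r0 => r0) (fun x y _ _ xy => xy).
rewrite mul1e.
have -> : id \o (fun x => `|x|) \o Z = phi t a \o X.
  by apply/funext => w /=; rewrite ger0_norm// phi_ge0.
apply: le_trans; apply: le_measure; rewrite ?inE.
- exact: measurable_gt_mfun.
- rewrite [X in measurable X](_ : _ = Z @^-1` `[1, +oo[).
    exact: measurable_funPTI.
  by apply/seteqP; split=> w /=; rewrite in_itv/= andbT lee_fin ger0_norm ?phi_ge0.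
- move=> w /= tX; rewrite lee_fin ger0_norm ?phi_ge0// /phi le_max.
  by rewrite lerDr mulr_ge0 ?subr_ge0 ?orbT// ltW.
Qed.

Lemma is_derive_powR_affine (R : realType) (b c x : R) : 0 < c -> 0 <= x ->
  is_derive x 1 (fun x => (1 + x / c) `^ b) (b / c * (1 + x / c) `^ (b - 1)).
Proof.
move=> c0 x0.
have x1 : 0 < 1 + x / c by rewrite ltr_pwDl// divr_ge0// ltW.
have d1 : is_derive x 1 (fun x => 1 + x / c) c^-1.
  by apply: is_derive_eq; rewrite add0r scaler0 add0r mul1r; exact: mulr1.
have d2 := is_derive1_powR b x1.
have -> : b / c * (1 + x / c) `^ (b - 1) =
    b * (1 + x / c) `^ (b - 1) * c^-1 by rewrite mulrAC.
exact: (@is_derive1_comp _ (fun y => y `^ b) (fun x => 1 + x / c) _ _ _ d2 d1).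
Qed.

Lemma cvg_powR_affine (R : realType) (c : R) : 0 < c ->
  (1 + x / c) `^ (- c) @[x --> +oo] --> 0.
Proof.
move=> c0.
(* For a nonzero base, [powR] is the exponential of a multiple of the logarithm, so it suffices that
   c ln(1 + x/c) diverges. *)
apply: (@cvg_trans _ ((expR (- (c * ln (1 + x / c)))) @[x --> +oo])).
  apply: near_eq_cvg; near=> x; rewrite /powR gt_eqF ?mulNr//.
  by rewrite ltr_pwDl// divr_ge0// ltW.
apply: (@cvg_comp _ _ _ (fun x : R => c * ln (1 + x / c)) (fun y => expR (- y))
  _ +oo _ _ (@cvgr_expR R)).
apply/cvgryPge => A; near=> x.
rewrite mulrC -ler_pdivrMr// -[leLHS]expRK ler_ln ?posrE ?expR_gt0//.
  by rewrite ler_wpDl// ler_pdivlMr.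
by rewrite ltr_pwDl// divr_ge0// ltW.
Unshelve. all: by end_near. Qed.

Lemma continuous_powR_affine (R : realType) (b c x : R) : 0 < c -> 0 <= x ->
  (1 + y / c) `^ b @[y --> x] --> (1 + x / c) `^ b.
Proof.
move=> c0 x0; apply: (@differentiable_continuous _ _ _ _ (fun y : R => (1 + y / c) `^ b)).
rewrite -derivable1_diffP.
by have [] := is_derive_powR_affine b c0 x0.
Qed.

Lemma within_continuous_powR_affine (R : realType) (b c : R) : 0 < c ->
  {within `[0, +oo[, continuous (fun x : R => (1 + x / c) `^ b)}.
Proof.
move=> c0; apply: derivable_within_continuous => x.
rewrite in_itv/= andbT => x0.
by have [] := is_derive_powR_affine b c0 x0.
Qed.

(** The exponent and the scale match: -(1 + x/c)^(-c) is an exact antiderivative, rising from -1 at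
    0 to 0 at infinity. *)
Lemma integral_powR_affine (R : realType) (c : R) : 0 < c ->
  (\int[lebesgue_measure]_(x in `[0%R, +oo[) ((1 + x / c) `^ (- c - 1))%:E = 1)%E.
Proof.
move=> c0.
have dF (x : R) : 0 <= x ->
    is_derive x 1 (fun x => - (1 + x / c) `^ (- c)) ((1 + x / c) `^ (- c - 1)).
  move=> x0; have := is_deriveN (is_derive_powR_affine (- c) c0 x0).
  by rewrite mulNr divff ?gt_eqF// mulN1r opprK.
rewrite (@ge0_continuous_FTC2y _ _ (fun x => - (1 + x / c) `^ (- c)) _ 0).
- by rewrite mul0r addr0 powR1 -EFinB sub0r opprK.
- by move=> x _; exact: powR_ge0.
- exact: within_continuous_powR_affine.
- by rewrite -[0]oppr0; apply: cvgN; exact: cvg_powR_affine.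
- by move=> x /ltW/dF[].
- by apply: cvg_at_right_filter; apply: cvgN; exact: continuous_powR_affine.
- by move=> x; rewrite in_itv/= andbT derive1E => /ltW/dF[].
Qed.

(** For r >= 0 this test function exceeds r exactly when its argument exceeds u (1 + r/(p - 1)). The
    layer-cake integrand is thus bounded by the hypothesis at v = 1 + r/(p - 1), and the bound
    integrates to [K]. *)
Lemma expectation_phi_le d (T : measurableType d) (R : realType)
    (P : probability T R) (Y : {RV P >-> R}) (u p K : R) :
    0 < u -> 1 < p -> 0 <= K ->
    (forall v, 1 <= v -> (P [set w | (u * v < Y w)%R] <= (K * v `^ (- p))%:E)%E) ->
  ('E_P[phi (p * u / (p - 1)) ((p - 1) / u) \o Y] <= K%:E)%E.
Proof.
move=> u0 p1 K0 tailY.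
have c0 : 0 < p - 1 by rewrite subr_gt0.
pose Z : {RV P >-> R} := phi (p * u / (p - 1)) ((p - 1) / u) \o Y.
rewrite (@ge0_expectation_ccdf _ _ _ P Z); last by move=> w; exact: phi_ge0.
have mf : measurable_fun (`[0, +oo[%classic : set R)
    (fun r : R => ((1 + r / (p - 1)) `^ (- (p - 1) - 1))%:E).
  apply/measurable_EFinP; apply: subspace_continuous_measurable_fun => //.
  exact: within_continuous_powR_affine.
apply: (@le_trans _ _ (\int[lebesgue_measure]_(r in `[0%R, +oo[)
   (K%:E * ((1 + r / (p - 1)) `^ (- (p - 1) - 1))%:E))%E); last first.
  rewrite ge0_integralZl//.
  - by rewrite integral_powR_affine// mule1.
  - by move=> x _; rewrite lee_fin powR_ge0.
apply: ge0_le_integral => //=.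
- exact: measurable_funTS (ccdf_measurable Z).
- exact: measurable_funeM.
- move=> r; rewrite in_itv/= andbT => r0.
  (* The unsimplified exponent served to match [integral_powR_affine] with c = p - 1. *)
  have -> : - (p - 1) - 1 = - p by ring.
  have v1 : 1 <= 1 + r / (p - 1) by rewrite lerDl divr_ge0// ltW.
  apply: le_trans (tailY _ v1); rewrite le_eqVlt; apply/orP; left; apply/eqP.
  congr (P _); apply/seteqP.
  have E y : (r < phi (p * u / (p - 1)) ((p - 1) / u) y) =
             (u * (1 + r / (p - 1)) < y).
    (* Since r >= 0, the zero branch of the maximum never exceeds r. For the other branch, the two
       differences agree up to the positive factor (p - 1)/u. *)
    rewrite /phi lt_max ltNge r0/= -subr_gt0 -[RHS]subr_gt0.
    rewrite -(pmulr_rgt0 (y - _) (divr_gt0 c0 u0)); congr (0 < _).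
    by field; rewrite ?gt_eqF.
  by split=> w /=; rewrite in_itv/= andbT E.
Qed.

Lemma quantile_powR_tail d (T : measurableType d) (R : realType)
    (P : probability T R) (Y : {RV P >-> R}) (M gamma p : R) (Q : R -> R) :
    1 <= M -> 0 < p -> (forall t, 0 < t -> 0 < Q t) ->
    (forall s t : R, 0 < s -> s < t ->
      Q t * expR (- (t ^+ 2) / (2 * p)) <=
      M * (Q s * expR (- (s ^+ 2) / (2 * p)))) ->
    (forall t, 0 < t ->
      (P [set w | (Q t < Y w)%R] < (gamma * expR (- (t ^+ 2) / 2))%R%:E)%E) ->
  forall t v : R, 0 < t -> 1 <= v ->
    (P [set w | (M * Q t * v < Y w)%R] <=
      (gamma * expR (- (t ^+ 2) / 2) * v `^ (- p))%:E)%E.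
Proof.
move=> M1 p0 Q_gt0 hQ tailY t v t0 v1.
have v0 : 0 < v by exact: lt_le_trans v1.
have lnv : 0 <= ln v by exact: ln_ge0.
(* Solves exp((s^2 - t^2)/(2p)) = v; the root is real and at least t because v >= 1. *)
pose s := Num.sqrt (t ^+ 2 + 2 * p * ln v).
have s2 : s ^+ 2 = t ^+ 2 + 2 * p * ln v.
  by rewrite sqr_sqrtr// addr_ge0 ?sqr_ge0// !mulr_ge0// ltW.
have s0 : 0 < s.
  by rewrite sqrtr_gt0 ltr_wpDr ?exprn_gt0// !mulr_ge0// ltW.
have ts : t <= s.
  have : t ^+ 2 <= s ^+ 2 by rewrite s2 lerDl !mulr_ge0// ltW.
  by rewrite ler_pXn2r// nnegrE ltW.
have Qs : Q s <= M * Q t * v.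
  (* The growth condition needs t < s strictly; when s = t, [M >= 1] and [v >= 1] give the bound
     directly. *)
  move: ts; rewrite le_eqVlt => /predU1P[<-|ts].
    have Qt0 := ltW (Q_gt0 _ t0).
    apply: le_trans (ler_peMl Qt0 M1) _.
    by rewrite ler_peMr// mulr_ge0// (le_trans ler01).
  have := hQ _ _ t0 ts.
  have -> : - s ^+ 2 / (2 * p) = - t ^+ 2 / (2 * p) - ln v.
    by rewrite s2; field; rewrite gt_eqF.
  rewrite expRD expRN lnK// mulrA ler_pdivrMr// mulrA mulrAC.
  by rewrite ler_pM2r ?expR_gt0.
(* As s^2/2 = t^2/2 + p ln v, the power of v is exactly the extra Gaussian decay between t and s. *)
have -> : gamma * expR (- t ^+ 2 / 2) * v `^ (- p) = gamma * expR (- s ^+ 2 / 2).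
  rewrite -mulrA /powR gt_eqF// -expRD s2; congr (_ * expR _).
  by field.
apply: (le_trans _ (ltW (tailY _ s0))).
apply: le_measure; rewrite ?inE.
- exact: measurable_gt_mfun.
- exact: measurable_gt_mfun.
- by move=> w /=; exact: le_lt_trans.
Qed.

Theorem proposition6 (R : realType)
  (dX : measure_display) (OmegaX : measurableType dX) (PX : probability OmegaX R)
  (X : {RV PX >-> R})
  (dY : measure_display) (OmegaY : measurableType dY) (PY : probability OmegaY R)
  (Y : {RV PY >-> R})
  (Ypos_fin : ('E_PY[(fun w => Num.max 0 (Y w))%R] < +oo)%E)
  (XleY : forall f : R -> R, Estar f -> ('E_PX[(f \o X)%R] <= 'E_PY[(f \o Y)%R])%E)
  (T gamma p : R) (hT : 1 <= T) (hgamma : 1 <= gamma) (hp : 1 < p)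
  (Q : R -> R) (Q_gt0 : forall t : R, 0 < t -> 0 < Q t)
  (hQ : forall s t : R, 0 < s -> s < t ->
    Q t * expR (- (t ^+ 2) / (2 * p)) <= T * (Q s * expR (- (s ^+ 2) / (2 * p))))
  (tailY : forall t : R, 0 < t ->
    (PY [set w | (Q t < Y w)%R] < (gamma * expR (- (t ^+ 2) / 2))%R%:E)%E) :
  forall t : R, 0 < t ->
    (PX [set w | (p * T / (p - 1) * Q t < X w)%R]
       <= (gamma * expR (- (t ^+ 2) / 2))%R%:E)%E.
Proof.
move=> t t0.
have u0 : 0 < T * Q t by rewrite mulr_gt0 ?Q_gt0// (lt_le_trans _ hT).
have a0 : 0 < (p - 1) / (T * Q t) by rewrite divr_gt0// subr_gt0.
(* Regroups the threshold as p u/(p - 1) with u = T Q(t), the point where the test function of slope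
   (p - 1)/u equals 1. *)
have -> : p * T / (p - 1) * Q t = p * (T * Q t) / (p - 1).
  by rewrite mulrAC !mulrA.
apply: le_trans (prob_gt_le_expectation_phi X _ a0) _.
apply: le_trans (XleY _ _) _; first by do 2 eexists; split; first exact: a0.
apply: expectation_phi_le => //.
  by rewrite mulr_ge0 ?expR_ge0// (le_trans _ hgamma).
move=> v v1; apply: (quantile_powR_tail hT _ Q_gt0 hQ tailY) => //.
exact: lt_trans hp.
Qed.
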